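(* Let $\Gamma$ be a finite abelian group of order $n$ with identity $e$, and let $R,S,T \subseteq \Gamma$ with $R = R^{-1}$, $S = S^{-1}$ and $e \notin R \cup S$. Let $G = SC(\Gamma;R,S,T)$ be the semi-Cayley graph defined in the context. Then $\frac{\lambda_3(G)}{2n} \le \frac13$.
   Context: The semi-Cayley graph $SC(\Gamma;R,S,T)$ has vertex set $\Gamma \times \{0,1\}$, and $(h,i) \sim (g,j)$ if and only if one of the following holds: $i=j=0$ and $gh^{-1} \in R$; $i=j=1$ and $gh^{-1}\in S$; $i=0$, $j=1$ and $gh^{-1} \in T$ (the graph is undirected). $\lambda_3$ denotes the third largest eigenvalue (with multiplicity) of the adjacency matrix. *)

(* Defs.v *)
From HB Require Import structures.
From mathcomp Require Import all_boot all_order all_algebra all_fingroup.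
Set Implicit Arguments. Unset Strict Implicit. Unset Printing Implicit Defensive.
Import Order.TTheory GRing.Theory Num.Theory.

(* Semi-Cayley graph SC(Gamma; R, S, T) on vertex set Gamma * bool,
   where false encodes 0 and true encodes 1.
   (h,i) ~ (g,j) iff
     i = j = 0 and g h^-1 \in R;  i = j = 1 and g h^-1 \in S;
     i = 0, j = 1 and g h^-1 \in T;  (undirected:) i = 1, j = 0 and h g^-1 \in T. *)
Definition semiCayley_adj (gT : finGroupType) (R S T : {set gT})
    (u v : gT * bool) : bool :=
  let: (h, i) := u in let: (g, j) := v in
  match i, j with
  | false, false => (g * h^-1)%g \in R
  | true, true => (g * h^-1)%g \in S
  | false, true => (g * h^-1)%g \in T
  | true, false => (h * g^-1)%g \in T
  end.

Definition semiCayley_mx (F : nzRingType) (gT : finGroupType) (R S T : {set gT})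
    : 'M[F]_#|{: gT * bool}| :=
  \matrix_(i, j) (semiCayley_adj R S T (enum_val i) (enum_val j))%:R%R.

Definition eigenvalues_desc (F : rcfType) (m : nat) (A : 'M[F]_m) (s : seq F) :=
  char_poly A = (\prod_(x <- s) ('X - x%:P))%R /\ sorted (fun x y : F => (y <= x)%R) s.

(* Main.v *)
Require Import Defs.
From HB Require Import structures.
From mathcomp Require Import all_boot all_order all_algebra all_fingroup.
From mathcomp Require Import complex ring lra.
Import Order.TTheory GRing.Theory Num.Theory.

Set Implicit Arguments.
Unset Strict Implicit.
Unset Printing Implicit Defensive.

(** The adjacency matrix commutes with the translations of Gamma, so over
    F[i] there is a joint eigenbasis; each of its vectors has the form
    (g, b) |-> chi(g) v(b) for a character chi of Gamma, and its eigenvalue l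
    satisfies (l - chi(R)) (l - chi(S)) = |chi(T)|^2.  At most two of these
    eigenvalues exceed c = 2n/3:
    - if chi^2 <> 1 then l <= c, since every partial sum of chi is at most n/3
      in modulus (or, if chi^4 = 1, chi(R), chi(S) <= n/4 and |chi(T)| <= 3n/8);
    - two distinct real nontrivial characters satisfy
      |chi(B)| + |psi(B)| <= n/2 for every B, which excludes that both have an
      eigenvalue above c; both eigenvalues of one such character cannot exceed
      c, as their sum is chi(R) + chi(S) <= n;
    - if both eigenvalues of the trivial character exceed c, then R and S are
      so large, and T so small, that chi(R) <= n - |R|, chi(S) <= n - |S| and
      |chi(T)| <= |T| keep the eigenvalues of every other character below c. *)

(** * Characters with values in [F[i]] and bounds on their partial sums *)

Section CharacterSums.
Local Open Scope ring_scope.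
Local Open Scope complex_scope.
Context {F : rcfType} {gT : finGroupType}.
Implicit Types (chi psi : gT -> F[i]) (A : {set gT}) (z u : F[i]).

Local Notation Re := (@complex.Re F).
Local Notation Im := (@complex.Im F).

Definition is_character chi :=
  chi 1%g = 1 /\ forall g h, chi (g * h)%g = chi g * chi h.

Definition nontrivial chi := exists g, chi g != 1.

Definition charsum chi A := \sum_(g in A) chi g.

(** Valued in the ordered field [F], whereas the norm of [F[i]] takes its values in [F[i]]. *)
Definition sqnorm z : F := Re z ^+ 2 + Im z ^+ 2.

(** The sums over [B] and over its complement are opposite, so twice the left side is at most the
    full sum of absolute values. *)
Lemma normr_sum_le_half (I : finType) (f : I -> F) (B : {set I}) :
  \sum_i f i = 0 -> `|\sum_(i in B) f i| <= (\sum_i `|f i|) / 2.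
Proof.
rewrite (bigID (mem B)) /= => /eqP; rewrite addr_eq0 => /eqP Bc.
rewrite ler_pdivlMr // mulr_natr mulr2n [in leRHS](bigID (mem B)) /=.
by rewrite lerD ?ler_norm_sum // Bc normrN ler_norm_sum.
Qed.

Lemma Re_sum (I : finType) (P : pred I) (f : I -> F[i]) :
  Re (\sum_(i | P i) f i) = \sum_(i | P i) Re (f i).
Proof.
have ReD : {morph Re : x y / x + y} by case=> [a b] [c d].
exact: (big_morph Re ReD).
Qed.

Lemma sqnormE z : (sqnorm z)%:C = z * z^*.
Proof. by rewrite -sqr_normc -add_Re2_Im2. Qed.

Lemma sqnormM z u : sqnorm (z * u) = sqnorm z * sqnorm u.
Proof. by case: z u => [a b] [c d]; rewrite /sqnorm /=; ring. Qed.

Lemma sqnorm_ge0 z : 0 <= sqnorm z.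
Proof. by rewrite addr_ge0 ?sqr_ge0. Qed.

Lemma unit_Re_bound u : sqnorm u = 1 -> `|Re u| <= 1.
Proof.
rewrite /sqnorm => u1; rewrite -(@ler_pXn2r _ 2) ?nnegrE // expr1n real_normK ?num_real //.
by have := sqr_ge0 (Im u); lra.
Qed.

Lemma unit_Re2 u : sqnorm u = 1 -> Re u ^+ 2 = (1 + Re (u ^+ 2)) / 2.
Proof. by case: u => [a b]; rewrite (expr2 (a +i* b)) /sqnorm /= => u1; lra. Qed.

(** The power reduction cos^4 t = (3 + 4 cos 2t + cos 4t) / 8, from the double-angle formula at [u]
    and at [u ^+ 2]. *)
Lemma unit_Re4 u : sqnorm u = 1 ->
  Re u ^+ 4 = (3 + 4 * Re (u ^+ 2) + Re (u ^+ 4)) / 8.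
Proof.
move=> u1; have u2 : sqnorm (u ^+ 2) = 1 by rewrite expr2 sqnormM u1 mulr1.
have := unit_Re2 u2; rewrite -exprM => Re2.
rewrite -[4%N]/(2 * 2)%N exprM (unit_Re2 u1) expr_div_n sqrrD Re2 expr1n mul1r.
by field.
Qed.

Lemma rotate_to_real z :
  exists u, sqnorm u = 1 /\ Re (u * z) ^+ 2 = sqnorm z.
Proof.
case: z => a b; set s := sqnorm _.
have sE : s = a ^+ 2 + b ^+ 2 by [].
have [s0|s0] := eqVneq s 0.
  have a0 : a = 0 by have := sqr_ge0 a; have := sqr_ge0 b; nra.
  by exists 1; rewrite /sqnorm mul1r s0 a0 /= expr0n /= addr0 expr1n.
have t2 : Num.sqrt s ^+ 2 = s by rewrite sqr_sqrtr // sqnorm_ge0.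
set t := Num.sqrt s in t2.
have t0 : t != 0 by apply: contra_neq s0; rewrite -t2 => ->; rewrite expr0n.
(* The conjugate of [z] divided by its modulus. *)
exists ((a / t) +i* (- b / t)); rewrite /sqnorm /=; split.
  by rewrite !expr_div_n sqrrN -mulrDl -sE t2 divff.
have -> : a / t * a - - b / t * b = s / t by rewrite sE; field.
by rewrite expr_div_n t2 expr2 mulfK.
Qed.

Section OneCharacter.
Context (chi : gT -> F[i]) (chiP : is_character chi).

Lemma characterX k : is_character (fun g => chi g ^+ k).
Proof.
by case: chiP => chi1 chiM; split=> [|g h]; rewrite ?chi1 ?expr1n // chiM exprMn.
Qed.

Lemma character_expg g k : chi (g ^+ k)%g = chi g ^+ k.
Proof.
case: chiP => chi1 chiM; elim: k => [|k IHk]; first by rewrite expg0 expr0.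
by rewrite expgS exprS chiM IHk.
Qed.

Lemma character_sqnorm g : sqnorm (chi g) = 1.
Proof.
have: `|chi g| ^+ #[g]%g = 1.
  by rewrite -normrX -character_expg expg_order (proj1 chiP) normr1.
rewrite -(prednK (order_gt0 g)) => /eqP; rewrite pexpr_eq1 // => /eqP chi1.
by apply: complexI; rewrite add_Re2_Im2 chi1 expr1n.
Qed.

Lemma character_inv g : chi g^-1%g = (chi g)^*.
Proof.
case: chiP => chi1 chiM.
have cc1 : chi g * (chi g)^* = 1 by rewrite -sqnormE character_sqnorm.
have ci1 : chi g * chi g^-1%g = 1 by rewrite -chiM mulgV.
by apply: (@mulfI _ (chi g)); rewrite ?cc1 // -unitfE; apply/unitrPr; exists (chi g)^*.
Qed.

Lemma character_sum0 : nontrivial chi -> \sum_g chi g = 0.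
Proof.
case=> h ch1; case: chiP => _ chiM.
have: chi h * (\sum_g chi g) = \sum_g chi g.
  rewrite big_distrr /= [RHS](reindex_inj (mulgI h)) /=.
  by apply: eq_bigr => g _; rewrite chiM.
move/eqP; rewrite -subr_eq0 -{2}[\sum_g _]mul1r -mulrBl mulf_eq0 subr_eq0.
by rewrite (negPf ch1) => /eqP.
Qed.

Lemma charsum_inv A : charsum chi A^-1%g = (charsum chi A)^*.
Proof.
rewrite /charsum rmorph_sum /= (reindex_inj invg_inj) /=.
by apply: eq_big => [g|g _]; rewrite ?mem_invg ?invgK ?character_inv.
Qed.

End OneCharacter.

Section MomentBounds.
Context (chi : gT -> F[i]) (chiP : is_character chi).

Local Notation n := (#|gT|%:R : F).

Lemma sum_Re_expr0 u k : nontrivial (fun g => chi g ^+ k) ->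
  \sum_g Re ((u * chi g) ^+ k) = 0.
Proof.
move=> chik; rewrite -Re_sum; under eq_bigr do rewrite exprMn.
by rewrite -big_distrr /= (character_sum0 (characterX chiP k) chik) mulr0.
Qed.

Lemma rotated_sqnorm u g : sqnorm u = 1 -> sqnorm (u * chi g) = 1.
Proof. by move=> u1; rewrite sqnormM u1 character_sqnorm // mulr1. Qed.

Lemma sum_Re2 u : sqnorm u = 1 -> nontrivial (fun g => chi g ^+ 2) ->
  \sum_g Re (u * chi g) ^+ 2 = n / 2.
Proof.
move=> u1 chi2; under eq_bigr do rewrite unit_Re2 ?rotated_sqnorm //.
by rewrite -big_distrl big_split /= sum_Re_expr0 // sumr_const addr0.
Qed.

(** After power reduction the terms in chi^2 and chi^4 sum to zero, which leaves the constant
    3/8. *)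
Lemma sum_Re4 u : sqnorm u = 1 -> nontrivial (fun g => chi g ^+ 2) ->
  nontrivial (fun g => chi g ^+ 4) -> \sum_g Re (u * chi g) ^+ 4 = 3 / 8 * n.
Proof.
move=> u1 chi2 chi4; under eq_bigr do rewrite unit_Re4 ?rotated_sqnorm //.
rewrite -big_distrl !big_split /= -big_distrr /= !sum_Re_expr0 // sumr_const.
by rewrite -mulr_natr; field.
Qed.

Lemma nontrivial_expr k : nontrivial (fun g => chi g ^+ k) -> nontrivial chi.
Proof. by case=> g gk; exists g; apply: contra_neq gk => ->; rewrite expr1n. Qed.

Lemma Re_charsum_le u A : nontrivial chi ->
  `|Re (u * charsum chi A)| <= (\sum_g `|Re (u * chi g)|) / 2.
Proof.
move=> chi1; rewrite /charsum big_distrr /= Re_sum normr_sum_le_half //.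
by rewrite -Re_sum -big_distrr /= character_sum0 // mulr0.
Qed.

(** Some rotation [u] makes the sum real; its modulus is then at most half the total of the absolute
    values of Re (u chi(g)). *)
Lemma sqnorm_charsum_le (m : F) A : nontrivial chi ->
  (forall u, sqnorm u = 1 -> \sum_g `|Re (u * chi g)| <= 2 * m) ->
  sqnorm (charsum chi A) <= m ^+ 2.
Proof.
move=> chi1 le_m; have [u [u1 <-]] := rotate_to_real (charsum chi A).
have := Re_charsum_le u A chi1; have := le_m u u1.
move=> ? ?; have le1 : `|Re (u * charsum chi A)| <= m by lra.
by rewrite -real_normK ?num_real // lerXn2r ?nnegrE // (le_trans _ le1).
Qed.

(* The right-hand side touches |x| at x = 1/2 and meets it at x = 1, the values
   taken by a cubic character; its mean over a nonreal character with
   chi^4 <> 1 is exactly 2/3. *)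
Lemma normr_le_quartic (x : F) : `|x| <= 1 ->
  `|x| <= 2 / 9 + 11 / 9 * x ^+ 2 - 4 / 9 * x ^+ 4.
Proof.
rewrite -[4%N]/(2 * 2)%N exprM -(real_normK (num_real x)).
have := normr_ge0 x; move: `|x| => y y0 y1.
rewrite -subr_ge0.
have -> : 2 / 9 + 11 / 9 * y ^+ 2 - 4 / 9 * (y ^+ 2) ^+ 2 - y =
  (2 * y - 1) ^+ 2 * ((1 - y) * (y + 2)) / 9 by field.
by rewrite divr_ge0 // mulr_ge0 ?sqr_ge0 // mulr_ge0; lra.
Qed.

(** Here [x] serves for R and S, and [y] for T. Both can be n/3 unless chi^4 = 1. For chi of order 4
    a partial sum can have modulus sqrt(2) n/4 > n/3, and the smaller bound n/4 on the real parts
    compensates. *)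
Lemma nonreal_charsum_bounds : nontrivial (fun g => chi g ^+ 2) ->
  exists x y, [/\ 0 <= y, x + y <= 2 / 3 * n,
    forall A, Re (charsum chi A) <= x & forall A, sqnorm (charsum chi A) <= y ^+ 2].
Proof.
move=> chi2; have chi1 := nontrivial_expr chi2; have n0 : 0 <= n by [].
have sqnorm1 : sqnorm 1 = 1 by rewrite /sqnorm /= expr0n /= addr0 expr1n.
have Re_le m A : \sum_g `|Re (1 * chi g)| <= 2 * m -> Re (charsum chi A) <= m.
  move=> le_m; have := Re_charsum_le 1 A chi1; rewrite mul1r.
  by have := ler_norm (Re (charsum chi A)); lra.
case: (boolP [exists g, chi g ^+ 4 != 1]) => [/existsP chi4|/existsPn chi4].
  have le_m u : sqnorm u = 1 -> \sum_g `|Re (u * chi g)| <= 2 * (n / 3).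
    move=> u1; apply: (@le_trans _ _ (\sum_g (2 / 9 +
        11 / 9 * Re (u * chi g) ^+ 2 - 4 / 9 * Re (u * chi g) ^+ 4))).
      by apply: ler_sum => g _; rewrite normr_le_quartic ?unit_Re_bound ?rotated_sqnorm.
    rewrite sumrB big_split /= -!big_distrr /= sum_Re2 // sum_Re4 // sumr_const.
    by rewrite -mulr_natr; lra.
  exists (n / 3), (n / 3); split=> [||A|A]; [lra|lra|exact/Re_le/le_m|].
  exact: sqnorm_charsum_le.
exists (n / 4), (3 / 8 * n); split=> [||A|A];
  [lra|lra|apply: Re_le|apply: sqnorm_charsum_le => // u u1].
  (* As chi^4 = 1, the reductions of the second and fourth powers coincide. So the absolute value of
     Re chi(g) is 0 or 1 and equals its square, and the total is the second moment n/2. *)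
  under eq_bigr => g _.
    have -> : `|Re (1 * chi g)| = Re (1 * chi g) ^+ 2.
      rewrite mul1r; have g1 := character_sqnorm chiP g.
      have := unit_Re4 g1; have := unit_Re2 g1.
      rewrite (eqP (negbNE (chi4 g))) /= => r2 r4; rewrite -[in RHS]real_normK ?num_real //.
      have: `|Re (chi g)| ^+ 2 = `|Re (chi g)| ^+ 4.
        by rewrite -!normrX !ger0_norm ?exprn_even_ge0 // r4 r2; lra.
      have [->|y0 y4] := eqVneq (`|Re (chi g)|) 0; first by rewrite expr0n.
      suff /eqP : `|Re (chi g)| ^+ 2 = 1 by rewrite pexpr_eq1 // => /eqP ->; rewrite expr1n.
      by apply: (@mulfI _ (`|Re (chi g)| ^+ 2)); rewrite ?expf_neq0 // -exprD -y4 mulr1.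
    over.
  by rewrite sum_Re2 //; lra.
(* The bound |x| <= 1/4 + x^2 is the square of |x| - 1/2 being nonnegative; the mean becomes 1/4 +
   1/2 = 2 * 3/8. *)
apply: (@le_trans _ _ (\sum_g (1 / 4 + Re (u * chi g) ^+ 2))).
  apply: ler_sum => g _; rewrite -real_normK ?num_real //.
  by have := sqr_ge0 (`|Re (u * chi g)| - 1 / 2); lra.
by rewrite big_split /= sum_Re2 // sumr_const -mulr_natr; lra.
Qed.

End MomentBounds.
End CharacterSums.

(** * Characters with values 1 and -1 *)

Section RealCharacters.
Local Open Scope ring_scope.
Local Open Scope complex_scope.
Context {F : rcfType} {gT : finGroupType}.
Implicit Types (chi psi : gT -> F[i]) (A : {set gT}).

Local Notation Re := (@complex.Re F).
Local Notation n := (#|gT|%:R : F).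

Definition real_character chi := is_character chi /\ forall g, chi g ^+ 2 = 1.

Lemma real_character_val chi g : real_character chi ->
  chi g = (Re (chi g))%:C /\ (Re (chi g) = 1 \/ Re (chi g) = -1).
Proof.
case=> _ /(_ g) /eqP; rewrite sqrf_eq1 => /orP[] /eqP ->; split=> /=.
- by [].
- by left.
- by apply/eqP; rewrite eq_complex /= oppr0 !eqxx.
- by right.
Qed.

Lemma real_charsum chi A : real_character chi ->
  charsum chi A = (\sum_(g in A) Re (chi g))%:C.
Proof.
move=> chiR; rewrite rmorph_sum /=; apply: eq_bigr => g _.
by case: (real_character_val g chiR).
Qed.

(** For a sign e, chi + e psi has total sum 0, so its sum over A is at most half the total of |chi +
    e psi|. For values 1 and -1 this absolute value is 1 + e chi psi, with total n because chi psi
    is a nontrivial character. The two signs together bound the sum of the absolute values. *)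
Lemma real_character_pair chi psi A :
  real_character chi -> real_character psi -> nontrivial chi -> nontrivial psi ->
  (exists g, chi g != psi g) ->
  `|Re (charsum chi A)| + `|Re (charsum psi A)| <= n / 2.
Proof.
move=> chiR psiR chi1 psi1 [h chi_psi].
rewrite !real_charsum //=.
have prodP : is_character (fun g => chi g * psi g).
  case: chiR psiR => -[c1 cM] _ [[p1 pM] _]; split=> [|x y].
    by rewrite c1 p1 mulr1.
  by rewrite cM pM mulrACA.
have prod1 : nontrivial (fun g => chi g * psi g).
  exists h; apply: contra_neq chi_psi => cp1.
  by rewrite -[LHS]mulr1 -(proj2 psiR h) expr2 mulrA cp1 mul1r.
have sum0 (phi : gT -> F[i]) : is_character phi -> nontrivial phi -> \sum_g Re (phi g) = 0.
  by move=> phiP phi1; rewrite -Re_sum character_sum0.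
have sum_prod : \sum_g Re (chi g) * Re (psi g) = 0.
  rewrite -[RHS](sum0 _ prodP prod1); apply: eq_bigr => g _.
  have [-> _] := real_character_val g chiR.
  by have [-> _] := real_character_val g psiR; rewrite -rmorphM.
have combine (e : F) : e = 1 \/ e = -1 ->
    `|\sum_(g in A) Re (chi g) + e * \sum_(g in A) Re (psi g)| <= n / 2.
  move=> eP; rewrite big_distrr -big_split /=.
  apply: le_trans (normr_sum_le_half _ _) _.
    by rewrite big_split -big_distrr /= !sum0 ?mulr0 ?addr0 //; [case: psiR|case: chiR].
  have -> : n = \sum_g (1 + e * (Re (chi g) * Re (psi g))).
    by rewrite big_split -big_distrr /= sum_prod mulr0 addr0 sumr_const.
  rewrite ler_pM2r ?invr_gt0 // ler_sum // => g _.
  have [_ c] := real_character_val g chiR; have [_ p] := real_character_val g psiR.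
  by case: c p eP => -> [] -> [] ->; rewrite ler_norml; apply/andP; split; lra.
have := combine 1 (or_introl erefl); have := combine (-1) (or_intror erefl).
rewrite !ler_norml => /andP[? ?] /andP[? ?].
by case: (ger0P (\sum_(g in A) Re (chi g)));
  case: (ger0P (\sum_(g in A) Re (psi g))); lra.
Qed.

End RealCharacters.

(** * Real inequalities for the roots of (l - r)(l - s) = q *)

Section SecularEquation.
Local Open Scope ring_scope.
Context {F : realFieldType}.

(** If l > x + y, both factors exceed y and their product exceeds q. *)
Lemma secular_root_le (l r s q x y : F) : 0 <= y -> r <= x -> s <= x ->
  q <= y ^+ 2 -> (l - r) * (l - s) = q -> l <= x + y.
Proof.
move=> y0 rx sx qy lq; rewrite leNgt; apply/negP => l_gt.
have: y * y < (l - r) * (l - s) by apply: ltr_pM => //; lra.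
by rewrite lq; lra.
Qed.

(** With |a| and |b| in place of a and b, the product expands to at least 4/9 m^2 - 2/3 m (m/2) =
    m^2/9. *)
Lemma prod_gap_ge (m a b : F) : `|a| + `|b| <= m / 2 -> 0 <= m ->
  m ^+ 2 / 9 <= (2 / 3 * m - a) * (2 / 3 * m - b).
Proof.
move=> ab m0; have ha := ler_norm a; have hb := ler_norm b.
apply: (@le_trans _ _ ((2 / 3 * m - `|a|) * (2 / 3 * m - `|b|))).
  have := mulr_ge0 (normr_ge0 a) (normr_ge0 b).
  have : 0 <= m * (m / 2 - `|a| - `|b|) by rewrite mulr_ge0 //; lra.
  by lra.
have := normr_ge0 a; have := normr_ge0 b.
by move=> *; apply: ler_pM; lra.
Qed.

Lemma secular_gap_le (c l r s q : F) : c < l -> r < c -> s < c ->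
  (l - r) * (l - s) = q -> (c - r) * (c - s) <= q.
Proof. by move=> ? ? ? <-; apply: ler_pM; lra. Qed.

(* The gaps multiply to at least (m^2/9)^2, whereas AM-GM bounds |t1 t2| by
   m^2/16. *)
Lemma secular_pair (m l1 l2 r1 r2 s1 s2 t1 t2 : F) : 0 < m ->
  `|r1| + `|r2| <= m / 2 -> `|s1| + `|s2| <= m / 2 -> `|t1| + `|t2| <= m / 2 ->
  (l1 - r1) * (l1 - s1) = t1 ^+ 2 -> (l2 - r2) * (l2 - s2) = t2 ^+ 2 ->
  2 / 3 * m < l1 -> 2 / 3 * m < l2 -> False.
Proof.
move=> m0 rm sm tm e1 e2 l1m l2m.
have pr := prod_gap_ge rm (ltW m0); have ps := prod_gap_ge sm (ltW m0).
have hr1 := ler_norm r1; have hr2 := ler_norm r2.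
have hs1 := ler_norm s1; have hs2 := ler_norm s2.
have nr1 := normr_ge0 r1; have nr2 := normr_ge0 r2.
have ns1 := normr_ge0 s1; have ns2 := normr_ge0 s2.
have t1_ge : (2 / 3 * m - r1) * (2 / 3 * m - s1) <= t1 ^+ 2.
  by apply: secular_gap_le l1m _ _ e1; lra.
have t2_ge : (2 / 3 * m - r2) * (2 / 3 * m - s2) <= t2 ^+ 2.
  by apply: secular_gap_le l2m _ _ e2; lra.
have lower : m ^+ 2 / 9 * (m ^+ 2 / 9) <= (`|t1| * `|t2|) ^+ 2.
  rewrite -normrM real_normK ?num_real // exprMn.
  apply: le_trans (ler_pM _ _ pr ps) _; rewrite ?divr_ge0 ?sqr_ge0 // mulrACA.
  by apply: ler_pM => //; rewrite mulr_ge0 // subr_ge0; lra.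
have upper : `|t1| * `|t2| <= m ^+ 2 / 16.
  have := sqr_ge0 (`|t1| - `|t2|).
  have : (`|t1| + `|t2|) ^+ 2 <= (m / 2) ^+ 2.
    by rewrite lerXn2r ?nnegrE ?addr_ge0 //; lra.
  by lra.
have : (`|t1| * `|t2|) ^+ 2 <= (m ^+ 2 / 16) ^+ 2.
  have t0 : 0 <= `|t1| * `|t2| by rewrite mulr_ge0.
  by rewrite lerXn2r ?nnegrE // (le_trans t0).
have : 0 < m ^+ 2 * m ^+ 2 by rewrite mulr_gt0 // exprn_gt0.
by lra.
Qed.

(** The monic quadratic with roots l1, l2 is (x - r)(x - s) - t^2. It is positive at c = 2m/3, which
    lies below both roots, so r and s lie strictly on the same side of c; since r + s > 2c, both
    exceed c. Then (l - r')(l - s') >= (r - c)(s - c) > t^2 >= q. *)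
Lemma secular_trivial (m l1 l2 l r s t r' s' q : F) :
  l1 + l2 = r + s -> l1 * l2 = r * s - t ^+ 2 ->
  2 / 3 * m < l1 -> 2 / 3 * m < l2 -> 2 / 3 * m < l ->
  r' <= m - r -> s' <= m - s -> q <= t ^+ 2 ->
  (l - r') * (l - s') = q -> r <= m -> False.
Proof.
move=> tr det h1 h2 h r'r s's qt lq rm.
have gap : t ^+ 2 < (2 / 3 * m - r) * (2 / 3 * m - s).
  have : 0 < (l1 - 2 / 3 * m) * (l2 - 2 / 3 * m) by rewrite mulr_gt0 //; lra.
  have m_tr : m * (l1 + l2) = m * (r + s) by rewrite tr.
  by lra.
have rs_gt0 : 0 < (2 / 3 * m - r) * (2 / 3 * m - s) := le_lt_trans (sqr_ge0 t) gap.
have r_gt : 2 / 3 * m < r.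
  rewrite ltNge; apply/negP => r_le; move: rs_gt0; apply/negP; rewrite -leNgt.
  by apply: mulr_ge0_le0; lra.
have s_gt : 2 / 3 * m < s.
  rewrite ltNge; apply/negP => s_le; move: rs_gt0; apply/negP; rewrite -leNgt.
  by apply: mulr_le0_ge0; lra.
(* From 2m/3 < r <= m follows m > 0, so l - r' > r - m/3 >= r - 2m/3, and likewise for s. *)
have : (r - 2 / 3 * m) * (s - 2 / 3 * m) <= (l - r') * (l - s').
  by apply: ler_pM; lra.
by rewrite lq; lra.
Qed.

End SecularEquation.

(** * Simultaneous diagonalization of the adjacency matrix and the translations *)

Lemma char_poly_similar (K : fieldType) m (P A B : 'M[K]_m) :
  P \in unitmx -> (P *m A = B *m P)%R -> char_poly A = char_poly B.
Proof.
move=> Pu PA.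
have : (map_mx polyC P *m char_poly_mx A = char_poly_mx B *m map_mx polyC P)%R.
  rewrite /char_poly_mx mulmxBr mulmxBl -!map_mxM /= PA.
  by rewrite mul_mx_scalar mul_scalar_mx.
move/(congr1 determinant); rewrite !det_mulmx mulrC.
by apply: mulIf; rewrite det_map_mx polyC_eq0 -unitfE -unitmxE.
Qed.

Section TranslationEigenbasis.
Local Open Scope ring_scope.
Local Open Scope complex_scope.
Context {F : rcfType} {gT : finGroupType} (R S T : {set gT}).

Local Notation C := F[i].
Local Notation V := (gT * bool)%type.
Local Notation N := #|{: V}|.
Local Notation A := (semiCayley_mx C R S T).

(** Multiplication is on the right because adjacency depends only on [g * h^-1], which (g, h) ->
    (gx, hx) preserves. *)
Definition translate (x : gT) (v : V) : V := ((v.1 * x)%g, v.2).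

Definition translation_mx (x : gT) : 'M[C]_N :=
  \matrix_(i, j) (enum_val i == translate x (enum_val j))%:R.

Lemma mulmx_translation m (M : 'M[C]_(m, N)) x i j :
  (M *m translation_mx x) i j = M i (enum_rank (translate x (enum_val j))).
Proof.
rewrite mxE (bigD1 (enum_rank (translate x (enum_val j)))) //= mxE enum_rankK eqxx mulr1.
rewrite big1 ?addr0 // => k /negPf kj; rewrite mxE -(inj_eq enum_rank_inj) enum_valK.
by rewrite kj mulr0.
Qed.

Lemma translation_mulmx m (M : 'M[C]_(N, m)) x i j :
  (translation_mx x *m M) i j = M (enum_rank (translate x^-1 (enum_val i))) j.
Proof.
rewrite mxE (bigD1 (enum_rank (translate x^-1 (enum_val i)))) //= mxE enum_rankK.
have tK : translate x (translate x^-1 (enum_val i)) = enum_val i.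
  by rewrite /translate /= mulgKV; case: (enum_val i).
rewrite tK eqxx mul1r big1 ?addr0 // => k kj.
rewrite mxE; case: eqP => [ik|]; last by rewrite mul0r.
case/eqP: kj; apply: enum_val_inj; rewrite enum_rankK ik /translate /= mulgK.
by case: (enum_val k).
Qed.

Lemma translation_comm_adjacency x : comm_mx (translation_mx x) A.
Proof.
apply/matrixP => i j; rewrite translation_mulmx mulmx_translation !mxE !enum_rankK.
case: (enum_val i) (enum_val j) => [h b] [g c]; rewrite /translate /=.
by case: b c => [] [] /=; rewrite !invMg ?invgK ?mulgA ?mulgK //
  -?mulgA ?mulgKV ?mulKg ?mulVKg.
Qed.

Lemma translation_comm x y : abelian [set: gT] ->
  comm_mx (translation_mx x) (translation_mx y).
Proof.
move=> abG; apply/matrixP => i j; rewrite !mulmx_translation !mxE !enum_rankK.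
rewrite /translate /= -!mulgA; congr ((_ == (_ * _, _))%g%:R).
by apply: (centsP abG); rewrite inE.
Qed.

Lemma translation_normal x : translation_mx x \is normalmx.
Proof.
(* A permutation matrix is unitary: its adjoint is the inverse translation. *)
have tr : ((translation_mx x)^t*)%sesqui = translation_mx x^-1.
  apply/matrixP => i j; rewrite !mxE conjC_nat; congr (_%:R).
  rewrite /translate; case: (enum_val i) (enum_val j) => [h b] [g c] /=.
  rewrite !xpair_eqE (eq_sym c); congr (_ && _).
  by apply/eqP/eqP => ->; rewrite ?mulgK ?mulgKV.
apply/normalmxP; rewrite tr; apply/matrixP => i j; rewrite !mulmx_translation !mxE !enum_rankK.
by rewrite /translate /= mulgK mulgKV.
Qed.

Hypothesis symR : R^-1%g = R.
Hypothesis symS : S^-1%g = S.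

Lemma adjacency_normal : A \is normalmx.
Proof.
apply: symmetric_normalmx.
  apply/is_hermitianmxP; rewrite expr0 scale1r; apply/matrixP => i j.
  rewrite !mxE; congr (_%:R).
  case: (enum_val i) (enum_val j) => [h b] [g c] /=.
  case: b c => [] [] //; first by rewrite -symS mem_invg invMg invgK symS.
  by rewrite -symR mem_invg invMg invgK symR.
by apply/mxOverP => i j; rewrite mxE realn.
Qed.

Lemma normal_diagonalizable (M : 'M[C]_N) : M \is normalmx -> diagonalizable M.
Proof.
move=> /orthomx_spectralP Mn; exists (spectralmx M); first exact: spectral_unit.
apply/similar_diagPex; exists (spectral_diag M).
by apply/(similarP (spectral_unit M)); rewrite {2}Mn !mulmxA mulmxV ?spectral_unit // mul1mx.
Qed.

(** The matrices commute pairwise and each is normal, hence diagonalizable, so one [P] diagonalizes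
    all of them. Its rows are joint left eigenvectors. *)
Lemma joint_eigenbasis : abelian [set: gT] ->
  exists2 P : 'M[C]_N, P \in unitmx &
    (exists d, P *m A = diag_mx d *m P) /\
    forall x, exists d, P *m translation_mx x = diag_mx d *m P.
Proof.
move=> abG; pose Ms := A :: [seq translation_mx x | x <- enum gT].
have [P Pu /allP PMs] : codiagonalizable Ms.
  apply/codiagonalizableP; split=> [X Y|X].
    rewrite !inE => /predU1P[->|/mapP[x _ ->]] /predU1P[->|/mapP[y _ ->]] //.
    - exact/comm_mx_sym/translation_comm_adjacency.
    - exact/translation_comm_adjacency.
    - exact: translation_comm.
  rewrite inE => /predU1P[->|/mapP[x _ ->]]; apply: normal_diagonalizable.
    exact: adjacency_normal.
  exact: translation_normal.
exists P => //; split=> [|x].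
  have /similar_diagPex[d /(similarP Pu) Pd] := PMs A (mem_head _ _).
  by exists d.
have /similar_diagPex[d /(similarP Pu) Pd] : similar_diag P (translation_mx x).
  by apply: PMs; rewrite inE map_f ?orbT ?mem_enum.
by exists d.
Qed.

End TranslationEigenbasis.

(** * Reduction to one 2x2 block per character *)

Section FourierBlocks.
Local Open Scope ring_scope.
Local Open Scope complex_scope.
Context {F : rcfType} {gT : finGroupType} (R S T : {set gT}).
Hypothesis symR : R^-1%g = R.
Hypothesis symS : S^-1%g = S.

Local Notation C := F[i].
Local Notation N := #|{: gT * bool}|.
Local Notation A := (semiCayley_mx C R S T).
Local Notation Re := (@complex.Re F).

(** The eigenvalue equation of the matrix with diagonal chi(R), chi(S) and off-diagonal entries
    chi(T) and its conjugate. The vector [v] may be zero here. *)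
Definition block_eigenpair (chi : gT -> C) (l : F) (v : bool -> C) :=
  l%:C * v false = charsum chi R * v false + charsum chi T * v true /\
  l%:C * v true = (charsum chi T)^* * v false + charsum chi S * v true.

Lemma mulmx_character_row m (P : 'M[C]_(m, N)) k chi : is_character chi ->
  (forall g b, P k (enum_rank (g, b)) = chi g * P k (enum_rank (1%g, b))) ->
  forall l, (forall j, (P *m A) k j = l%:C * P k j) ->
  block_eigenpair chi l (fun b => P k (enum_rank (1%g, b))).
Proof.
move=> chiP Pk l PA.
have rowE b : (P *m A) k (enum_rank (1%g, b)) =
    \sum_(h | semiCayley_adj R S T (h, false) (1%g, b)) chi h * P k (enum_rank (1%g, false)) +
    \sum_(h | semiCayley_adj R S T (h, true) (1%g, b)) chi h * P k (enum_rank (1%g, true)).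
  rewrite mxE (reindex (@enum_rank {: gT * bool})) /=; last exact/onW_bij/enum_rank_bij.
  rewrite (eq_bigr (fun w => P k (enum_rank (w.1, w.2)) *
    (semiCayley_adj R S T (w.1, w.2) (1%g, b))%:R)); last first.
    by case=> h c _; rewrite mxE !enum_rankK.
  rewrite -(pair_bigA _ (fun h c => P k (enum_rank (h, c)) *
    (semiCayley_adj R S T (h, c) (1%g, b))%:R)) /= exchange_big big_bool /= addrC.
  by congr (_ + _); rewrite [RHS]big_mkcond /=; apply: eq_bigr => h _;
    rewrite (Pk h); case: b => /=; case: (_ \in _); rewrite ?mulr1 ?mulr0.
(* The condition [1 * h^-1 \in B] makes h run over B^-1: this changes nothing for R and S, and
   conjugates chi(T) in the second equation. *)
have sumV (B : {set gT}) (x : C) :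
    \sum_(h | (1 * h^-1)%g \in B) chi h * x = charsum chi B^-1%g * x.
  by rewrite /charsum big_distrl /=; apply: eq_bigl => h; rewrite mul1g mem_invg.
by split; rewrite -PA rowE /= ?sumV ?symR ?symS ?charsum_inv //; congr (_ + _);
  rewrite /charsum big_distrl /=; apply: eq_bigl => h; rewrite invg1 mulg1.
Qed.

(** Row k of the eigenbasis has the form (g, b) -> chi(g) v(b), where chi(x) is the eigenvalue of
    the translation by x on that row. The independence clause carries the multiplicities: it will
    limit how many indices share a character. *)
Lemma semiCayley_blocks (s : seq F) : abelian [set: gT] ->
  char_poly (semiCayley_mx F R S T) = \prod_(x <- s) ('X - x%:P) ->
  exists (lam : 'I_N -> F) (chi : 'I_N -> gT -> C) (v : 'I_N -> bool -> C),
  [/\ perm_eq s [seq lam k | k : 'I_N],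
      forall k, is_character (chi k),
      forall k, block_eigenpair (chi k) (lam k) (v k) &
      forall a : 'I_N -> C, (forall g b, \sum_k a k * (chi k g * v k b) = 0) ->
      forall k, a k = 0].
Proof.
move=> abG chars.
have [P Pu [[d PA] Pt]] := @joint_eigenbasis F gT R S T symR symS abG.
have [chi Pchi] := fin_all_exists Pt.
have AE : A = map_mx (real_complex F) (semiCayley_mx F R S T).
  by apply/matrixP => i j; rewrite !mxE rmorph_nat.
(* Similar matrices have the same characteristic polynomial, and its roots determine the multiset;
   in particular every diagonal entry is real. *)
have chars_d : perm_eq [seq x%:C | x <- s] [seq d 0 k | k : 'I_N].
  apply: prod_XsubC_eq; rewrite big_map -(map_prod_XsubC (real_complex F)).
  rewrite -chars map_char_poly -AE.
  rewrite (char_poly_similar Pu PA) char_poly_trig; last exact/diag_mx_is_trig.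
  by rewrite big_image /=; apply: eq_bigr => k _; rewrite mxE eqxx.
have d_real k : d 0 k = (Re (d 0 k))%:C.
  have : d 0 k \in [seq x%:C | x <- s] by rewrite (perm_mem chars_d) map_f ?mem_enum.
  by case/mapP => x _ ->.
have PkE x k g b : P k (enum_rank ((g * x)%g, b)) = chi x 0 k * P k (enum_rank (g, b)).
  have /matrixP/(_ k (enum_rank (g, b))) := Pchi x.
  by rewrite mulmx_translation mul_diag_mx mxE enum_rankK.
have rowN0 k : exists g b, P k (enum_rank (g, b)) != 0.
  case: (pickP (fun w : gT * bool => P k (enum_rank w) != 0)) => [[g b]|Pk0].
    by exists g, b.
  have row0 : row k P = 0.
    by apply/rowP => j; rewrite !mxE -[j]enum_valK; apply/eqP/negbFE/Pk0.
  have : delta_mx 0 k = 0 :> 'rV[C]_N by rewrite -(mulmxK Pu (delta_mx 0 k)) -rowE row0 mul0mx.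
  by move/rowP/(_ k)/eqP; rewrite !mxE !eqxx oner_eq0.
(* Multiplicativity follows by cancelling a nonzero entry of row k. *)
have chiP k : is_character (fun x => chi x 0 k).
  have [g [b Pk]] := rowN0 k; split=> [|x y]; apply: (mulIf Pk).
    by rewrite -PkE mulg1 mul1r.
  by rewrite -PkE mulgA PkE PkE mulrCA mulrA.
exists (fun k => Re (d 0 k)), (fun k x => chi x 0 k), (fun k b => P k (enum_rank (1%g, b))).
have PkF k g b : P k (enum_rank (g, b)) = chi g 0 k * P k (enum_rank (1%g, b)).
  by rewrite -PkE mul1g.
split=> // [|k|a a0 k].
- have -> : s = [seq Re x | x <- [seq x%:C | x <- s]] by rewrite -map_comp map_id_in.
  by rewrite (perm_trans (perm_map _ chars_d)) // -map_comp.
- apply: mulmx_character_row => // j.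
  by rewrite PA mul_diag_mx mxE -d_real.
have aP : (\row_k a k) *m P = 0.
  apply/rowP => j; rewrite !mxE -[RHS](a0 (enum_val j).1 (enum_val j).2).
  apply: eq_bigr => l _; rewrite mxE -PkF; congr (_ * P _ _).
  by rewrite -surjective_pairing enum_valK.
have /rowP/(_ k) : (\row_k a k) = 0 by rewrite -(mulmxK Pu (\row_k a k)) aP mul0mx.
by rewrite !mxE.
Qed.

Lemma charsum_sym_real (chi : gT -> C) (B : {set gT}) : is_character chi -> B^-1%g = B ->
  charsum chi B = (Re (charsum chi B))%:C.
Proof.
move=> chiP symB; have := charsum_inv chiP B; rewrite symB.
case: (charsum chi B) => a b [/eqP]; rewrite -subr_eq0 opprK -mulr2n mulrn_eq0 /= => /eqP -> .
by [].
Qed.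

(** Combine the two equations and cancel a nonzero coordinate of [v]. *)
Lemma block_secular (chi : gT -> C) l v : is_character chi ->
  block_eigenpair chi l v -> v false != 0 \/ v true != 0 ->
  (l - Re (charsum chi R)) * (l - Re (charsum chi S)) = sqnorm (charsum chi T).
Proof.
move=> chiP [e0 e1] vN0; apply: complexI.
rewrite sqnormE rmorphM !rmorphB /= -!charsum_sym_real //.
set r := charsum chi R in e0 *; set s := charsum chi S in e1 *.
set t := charsum chi T in e0 e1 *; set x := l%:C in e0 e1 *.
have f0 : (x - r) * v false = t * v true by rewrite mulrBl e0; ring.
have f1 : (x - s) * v true = t^* * v false by rewrite mulrBl e1; ring.
case: vN0 => vN0; apply: (mulIf vN0).
  by rewrite mulrAC f0 -mulrA -[RHS]mulrA -f1; ring.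
by rewrite -mulrA f1 mulrCA f0; ring.
Qed.

(** For the block M and the wedge product, Mv^w + v^Mw = tr(M) v^w and Mv^Mw = det(M) v^w; the
    nonzero v^w cancels. This also covers l = m. *)
Lemma block_trace_det (chi : gT -> C) l m v w : is_character chi ->
  block_eigenpair chi l v -> block_eigenpair chi m w ->
  v false * w true - v true * w false != 0 ->
  l + m = Re (charsum chi R) + Re (charsum chi S) /\
  l * m = Re (charsum chi R) * Re (charsum chi S) - sqnorm (charsum chi T).
Proof.
move=> chiP [e0 e1] [f0 f1] D0; split; apply: complexI.
  rewrite !rmorphD /= -!charsum_sym_real //; apply: (mulIf D0).
  transitivity ((l%:C * v false) * w true - (l%:C * v true) * w false +
    ((m%:C * w true) * v false - (m%:C * w false) * v true)); first by ring.
  by rewrite e0 e1 f0 f1; ring.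
rewrite rmorphB !rmorphM /= sqnormE -!charsum_sym_real //; apply: (mulIf D0).
transitivity ((l%:C * v false) * (m%:C * w true) - (l%:C * v true) * (m%:C * w false)).
  by ring.
by rewrite e0 e1 f0 f1; ring.
Qed.

End FourierBlocks.

(** * At most two eigenvalues exceed 2n/3 *)

Section LargeEigenvalues.
Local Open Scope ring_scope.
Local Open Scope complex_scope.
Context {F : rcfType} {gT : finGroupType} (R S T : {set gT}).
Hypothesis symR : R^-1%g = R.
Hypothesis symS : S^-1%g = S.

Local Notation C := F[i].
Local Notation Re := (@complex.Re F).
Local Notation n := (#|gT|%:R : F).
Implicit Types (chi : gT -> C) (B : {set gT}).

Lemma character_Re_bound chi (u : C) g : is_character chi -> sqnorm u = 1 ->
  `|Re (u * chi g)| <= 1.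
Proof. by move=> chiP u1; rewrite unit_Re_bound // sqnormM u1 character_sqnorm // mulr1. Qed.

Lemma charsum_trivial chi B : (forall g, chi g = 1) -> charsum chi B = #|B|%:R.
Proof. by move=> chi1; rewrite -sumr_const; apply: eq_bigr. Qed.

Lemma sqnorm_charsum_le_card chi B : is_character chi ->
  sqnorm (charsum chi B) <= #|B|%:R ^+ 2.
Proof.
move=> chiP; have [u [u1 <-]] := rotate_to_real (charsum chi B).
rewrite -real_normK ?num_real // lerXn2r ?nnegrE // big_distrr /= Re_sum.
apply: le_trans (ler_norm_sum _ _ _) _.
by rewrite -sumr_const; apply: ler_sum => g _; apply: character_Re_bound.
Qed.

(** The sum over [B] is minus the sum over its complement, whose terms have real part at least
    -1. *)
Lemma Re_charsum_le_compl chi B : is_character chi -> nontrivial chi ->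
  Re (charsum chi B) <= n - #|B|%:R.
Proof.
move=> chiP chi1; have := congr1 Re (character_sum0 chiP chi1).
rewrite Re_sum (bigID (mem B)) /= -Re_sum -[\sum_(i in B) _]/(charsum chi B).
have : - (n - #|B|%:R) <= \sum_(g | g \notin B) Re (chi g).
  have -> : n - #|B|%:R = \sum_(g | g \notin B) 1.
    rewrite -(cardC (mem B)) natrD addrAC subrr add0r -sumr_const.
    by apply: eq_bigl => g.
  rewrite -sumrN; apply: ler_sum => g _.
  by have := unit_Re_bound (character_sqnorm chiP g); rewrite ler_norml => /andP[].
by move=> ? ?; lra.
Qed.

Lemma nonreal_eigenvalue_le chi l v : is_character chi ->
  nontrivial (fun g => chi g ^+ 2) -> block_eigenpair R S T chi l v ->
  v false != 0 \/ v true != 0 -> l <= 2 / 3 * n.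
Proof.
move=> chiP chi2 ev vN0; have [x [y [y0 xy Rex sqy]]] := nonreal_charsum_bounds chiP chi2.
apply: le_trans xy; apply: secular_root_le y0 (Rex R) (Rex S) (sqy T) _.
exact: (block_secular symR symS chiP ev vN0).
Qed.

Lemma large_eigenvalue_real chi l v : is_character chi ->
  block_eigenpair R S T chi l v -> v false != 0 \/ v true != 0 ->
  2 / 3 * n < l -> real_character chi.
Proof.
move=> chiP ev vN0 l_gt; split=> // g; apply/eqP; apply: contraTT l_gt => g2.
by rewrite -leNgt; apply: nonreal_eigenvalue_le chiP _ ev vN0; exists g.
Qed.

Context (I : finType) (lam : I -> F) (chi : I -> gT -> C) (v : I -> bool -> C).
Hypothesis chiP : forall k, is_character (chi k).
Hypothesis eigen : forall k, block_eigenpair R S T (chi k) (lam k) (v k).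
Hypothesis indep : forall a : I -> C,
  (forall g b, \sum_k a k * (chi k g * v k b) = 0) -> forall k, a k = 0.

(** The indices [l] and [m] may coincide, so relations between two vectors are covered as well. *)
Lemma independent_coef0 k l m (x y z : C) : k != l -> k != m ->
  (forall g b, x * (chi k g * v k b) + y * (chi l g * v l b) + z * (chi m g * v m b) = 0) ->
  x = 0.
Proof.
move=> kl km xyz0.
have delta (w : C) j (f : I -> C) : \sum_i w * (i == j)%:R * f i = w * f j.
  rewrite (bigD1 j) //= eqxx mulr1 big1 ?addr0 // => i /negPf ->.
  by rewrite mulr0 mul0r.
have := @indep (fun i => x * (i == k)%:R + y * (i == l)%:R + z * (i == m)%:R) _ k.
rewrite eqxx (negPf kl) (negPf km) mulr1 !mulr0 !addr0; apply=> g b.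
rewrite -[RHS](xyz0 g b) -!(delta _ _ (fun i => chi i g * v i b)) -!big_split /=.
by apply: eq_bigr => i _; rewrite !mulrDl.
Qed.

Lemma eigenvector_neq0 k l : k != l -> v k false != 0 \/ v k true != 0.
Proof.
move=> kl; case: (eqVneq (v k false) 0) => [v0|]; last by left.
right; apply/eqP => v1; have /eqP := oner_eq0 C; apply.
apply: (@independent_coef0 k l l 1 0 0) => // g [];
  by rewrite ?v0 ?v1 !mulr0 !mul0r !addr0.
Qed.

(** If the wedge vanishes, v_l(b) v_k - v_k(b) v_l = 0 for each b. As the characters agree, this is
    a dependency with coefficient v_l(b) at k, which forces v_l = 0. *)
Lemma wedge_neq0 k l : k != l -> (forall g, chi k g = chi l g) ->
  v k false * v l true - v k true * v l false != 0.
Proof.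
move=> kl kl_chi; apply/negP => /eqP D0.
have vl0 b : v l b = 0.
  apply: (@independent_coef0 k l l (v l b) (- v k b) 0) => // g c.
  rewrite mul0r addr0 kl_chi.
  have -> : v l b * (chi l g * v k c) + - v k b * (chi l g * v l c) =
    chi l g * (v k c * v l b - v k b * v l c) by ring.
  case: b c => [] []; rewrite ?D0 ?subrr ?mulr0 //.
  by rewrite -opprB D0 oppr0 mulr0.
by case: (@eigenvector_neq0 l k); rewrite 1?eq_sym // !vl0 eqxx.
Qed.

(* The coefficients of the dependency are the wedge products of the other two
   vectors. *)
Lemma no_three_same k l m : k != l -> k != m -> l != m ->
  (forall g, chi k g = chi l g) -> (forall g, chi k g = chi m g) -> False.
Proof.
move=> kl km lm kl_chi km_chi.
have lm_chi g : chi l g = chi m g by rewrite -kl_chi km_chi.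
have /negP := wedge_neq0 lm lm_chi; apply; apply/eqP.
apply: (@independent_coef0 k l m _ (v k true * v m false - v k false * v m true)
  (v k false * v l true - v k true * v l false)) => // g b.
rewrite kl_chi lm_chi.
by case: b; ring.
Qed.

Lemma no_two_nontrivial k l : k != l -> nontrivial (chi k) -> nontrivial (chi l) ->
  2 / 3 * n < lam k -> 2 / 3 * n < lam l -> False.
Proof.
move=> kl ck cl k_gt l_gt.
have vk := eigenvector_neq0 kl.
have vl : v l false != 0 \/ v l true != 0 by apply: (@eigenvector_neq0 _ k); rewrite eq_sym.
have kR := large_eigenvalue_real (chiP k) (eigen k) vk k_gt.
have lR := large_eigenvalue_real (chiP l) (eigen l) vl l_gt.
have n0 : 0 < n by rewrite ltr0n; apply/card_gt0P; exists 1%g.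
case: (boolP [exists g, chi k g != chi l g]) => [/existsP kl_chi|/existsPn kl_chi].
  (* Distinct real characters: the pair bound holds for each of R, S and T. *)
  have sq j : real_character (chi j) ->
      sqnorm (charsum (chi j) T) = Re (charsum (chi j) T) ^+ 2.
    by move=> jR; rewrite real_charsum // /sqnorm /= expr0n addr0.
  have pair B := real_character_pair B kR lR ck cl kl_chi.
  apply: (secular_pair n0 (pair R) (pair S) (pair T) _ _ k_gt l_gt); rewrite -sq //.
    exact: block_secular (chiP k) (eigen k) vk.
  exact: block_secular (chiP l) (eigen l) vl.
(* Equal characters: the two eigenvalues sum to the trace chi(R) + chi(S) <= n, less than 4n/3. *)
have kl_eq g : chi k g = chi l g by apply/eqP; rewrite -[_ == _]negbK.
have ev_l : block_eigenpair R S T (chi k) (lam l) (v l).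
  by have := eigen l; rewrite /block_eigenpair /charsum; under eq_bigr do rewrite -kl_eq;
    under [\sum_(g in T) _]eq_bigr do rewrite -kl_eq;
    under [\sum_(g in S) _]eq_bigr do rewrite -kl_eq.
have [tr _] := block_trace_det symR symS (chiP k) (eigen k) ev_l (wedge_neq0 kl kl_eq).
have half B : Re (charsum (chi k) B) <= n / 2.
  have := Re_charsum_le (chiP k) 1 B ck; rewrite mul1r => le_half.
  apply: le_trans (ler_norm _) (le_trans le_half _).
  rewrite ler_pM2r ?invr_gt0 // -sumr_const; apply: ler_sum => g _.
  by apply: character_Re_bound => //; rewrite /sqnorm /= expr1n expr0n addr0.
by have := half R; have := half S; lra.
Qed.

(** The trivial block has entries |R|, |S| and |T|, so [lam k] and [lam l] have sum |R| + |S| and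
    product |R||S| - |T|^2. *)
Lemma no_nontrivial_above_two_trivial k l m : k != l ->
  (forall g, chi k g = 1) -> (forall g, chi l g = 1) -> nontrivial (chi m) ->
  2 / 3 * n < lam k -> 2 / 3 * n < lam l -> 2 / 3 * n < lam m -> False.
Proof.
move=> kl ck cl cm k_gt l_gt m_gt.
have mk : m != k by apply/eqP => mk; case: cm => g; rewrite mk ck eqxx.
have kl_chi g : chi k g = chi l g by rewrite ck cl.
have ev_l : block_eigenpair R S T (chi k) (lam l) (v l).
  by have := eigen l; rewrite /block_eigenpair !charsum_trivial.
have [] := block_trace_det symR symS (chiP k) (eigen k) ev_l (wedge_neq0 kl kl_chi).
have RenatE B : Re (charsum (chi k) B) = #|B|%:R.
  by rewrite charsum_trivial // -(rmorph_nat (real_complex F)).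
have -> : sqnorm (charsum (chi k) T) = #|T|%:R ^+ 2.
  by rewrite charsum_trivial // -(rmorph_nat (real_complex F)) /sqnorm /= expr0n addr0.
rewrite !RenatE => tr det.
apply: (secular_trivial tr det k_gt l_gt m_gt (Re_charsum_le_compl R (chiP m) cm)
  (Re_charsum_le_compl S (chiP m) cm) (sqnorm_charsum_le_card T (chiP m))).
- exact: block_secular (chiP m) (eigen m) (eigenvector_neq0 mk).
- by rewrite ler_nat max_card.
Qed.

Lemma card_large_eigenvalues : (#|[set k | (2 / 3 * n < lam k)%R]| <= 2)%N.
Proof.
rewrite leqNgt; apply/card_gt2P => -[k [l [m [[]]]]]; rewrite !inE.
move=> k_gt l_gt m_gt [kl lm mk].
have lk : l != k by rewrite eq_sym.
have ml : m != l by rewrite eq_sym.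
have km : k != m by rewrite eq_sym.
have trivP j : nontrivial (chi j) \/ forall g, chi j g = 1.
  case: (boolP [exists g, chi j g != 1]) => [/existsP|/existsPn triv]; first by left.
  by right=> g; apply/eqP; rewrite -[_ == _]negbK.
(* Of three indices, two are nontrivial, or exactly one is, or all three share the trivial
   character. *)
case: (trivP k) (trivP l) (trivP m) => [ck|ck] [cl|cl] [cm|cm].
- exact: (no_two_nontrivial kl).
- exact: (no_two_nontrivial kl).
- exact: (no_two_nontrivial km).
- exact: (@no_nontrivial_above_two_trivial l m k).
- exact: (no_two_nontrivial lm).
- exact: (@no_nontrivial_above_two_trivial k m l).
- exact: (@no_nontrivial_above_two_trivial k l m).
- by apply: (no_three_same kl km lm) => g; rewrite ck ?cl ?cm.
Qed.

End LargeEigenvalues.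

(** * From the count to the third largest eigenvalue *)

(** A third entry above c would put three entries above c. The bound 0 <= c handles the default 0 on
    lists with fewer than three entries. *)
Lemma sorted_nth2_le (F : realFieldType) (s : seq F) (c : F) : (0 <= c)%R ->
  sorted (fun x y : F => (y <= x)%R) s ->
  (count (fun x => c < x)%R s <= 2)%N -> (nth 0 s 2 <= c)%R.
Proof.
case: s => [|x0 [|x1 [|x2 s]]] //= c0 /and3P[x10 x21 _].
case: (leP x2 c) => // cx2.
by rewrite (lt_le_trans cx2 x21) (lt_le_trans cx2 (le_trans x21 x10)) addnA.
Qed.

Theorem theorem3p9 (F : rcfType) (gT : finGroupType) (R S T : {set gT})
  (s : seq F) :
  abelian [set: gT] ->
  1 < #|gT| ->
  (R^-1)%g = R -> (S^-1)%g = S ->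
  (1%g \notin R :|: S) ->
  eigenvalues_desc (semiCayley_mx F R S T) s ->
  (nth 0 s 2 / (2 * #|gT|)%:R <= 1 / 3 :> F)%R.
Proof.
move=> abG gt1 symR symS _ [chars s_sorted].
have [lam [chi [v [s_lam chiP eigen indep]]]] := semiCayley_blocks symR symS abG chars.
have s2 : (nth 0 s 2 <= 2 / 3 * #|gT|%:R)%R.
  apply: sorted_nth2_le s_sorted _; first by rewrite mulr_ge0 ?divr_ge0.
  (* Counting in [s] with multiplicity becomes counting indices k. *)
  rewrite (seq.permP s_lam) count_map.
  apply: leq_trans (card_large_eigenvalues symR symS chiP eigen indep).
  by rewrite cardsE cardE -size_filter enumT.
rewrite ler_pdivrMr ?ltr0n ?muln_gt0 ?(ltnW gt1) // natrM.
by lra.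
Qed.
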